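(* Let $n\ge 2$ and let $\Gamma_{n-1}\subset\Gamma_n$ be an inclusion of Coxeter graphs of spherical type with vertex sets $\{x_1,\dots,x_{n-1}\}$ and $\{x_1,\dots,x_n\}$ respectively. Let $R_n=\Delta(\Gamma_n,\Gamma_{n-1})$ be the relative Garside element, let $\sigma_n$ be the bijection of $\{1,\dots,n\}$ with $x_i\Delta(\Gamma_n)=\Delta(\Gamma_n)x_{\sigma_n(i)}$, let $m=\sigma_n(n)$, and let $\sigma:\{1,\dots,n-1\}\to\{1,\dots,n\}\setminus\{m\}$ be the bijection with $x_iR_n=R_nx_{\sigma(i)}$. Suppose $U_n\in\mathcal{M}(\Gamma_n)$ satisfies: (a) $x_m^2\nmid U_n$; (b) for $i\in\{1,\dots,n\}$, $x_i\mid_L U_n$ if and only if $i=n$; (c) there are $k\in\{1,\dots,n\}$ and a bijection $\tau:\{1,\dots,n-1\}\to\{1,\dots,n\}\setminus\{k\}$ such that $x_iU_n=U_nx_{\tau(i)}$ for all $i\in\{1,\dots,n-1\}$. Then $U_n=R_n$ (and also $k=m$ and $\tau=\sigma$).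
   Context: A Coxeter matrix over a set $S$ is $M=(m_{st})_{s,t\in S}$ with $m_{ss}=1$ and $m_{st}=m_{ts}\in\{2,3,4,\dots,\infty\}$ for $s\ne t$; its Coxeter graph $\Gamma$ has vertex set $S$, an edge between $s,t$ when $m_{st}\ge3$, labelled by $m_{st}$ when $m_{st}\ge4$. The Artin monoid $\mathcal{M}(\Gamma)$ is the monoid generated by $S$ with relations $\underbrace{sts\cdots}_{m_{st}}=\underbrace{tst\cdots}_{m_{st}}$ for all $s\ne t$ with $m_{st}\neq\infty$. $\Gamma$ is of spherical type if the Coxeter group (obtained by adding the relations $s^2=1$) is finite. An inclusion $\Gamma_{n-1}\subset\Gamma_n$ means that $\Gamma_{n-1}$ is the full labelled subgraph of $\Gamma_n$ on the vertices $x_1,\dots,x_{n-1}$ (so $\Gamma_n$ has one new vertex $x_n$); $\mathcal{M}(\Gamma_{n-1})$ is regarded as the submonoid of $\mathcal{M}(\Gamma_n)$ generated by $x_1,\dots,x_{n-1}$. Divisibility in a monoid: $\alpha\mid\beta$ means $\beta=\lambda\alpha\rho$ for some $\lambda,\rho$; $\alpha\mid_L\beta$ means $\beta=\alpha\rho$ for some $\rho$. For $\Gamma$ of spherical type, the Garside element $\Delta(\Gamma)\in\mathcal{M}(\Gamma)$ is the unique element such that $s\mid_L\Delta(\Gamma)$ for every generator $s$, and whenever $s\mid_L\omega$ for all generators $s$ then $\Delta(\Gamma)\mid_L\omega$. One has $\Delta(\Gamma_{n-1})\mid_L\Delta(\Gamma_n)$, and the relative Garside element $R_n=\Delta(\Gamma_n,\Gamma_{n-1})$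 is the (unique, by cancellativity) element with $\Delta(\Gamma_n)=\Delta(\Gamma_{n-1})\,R_n$. It is a known fact that conjugation by the Garside element permutes the generators, which gives the bijection $\sigma_n$; the bijection $\sigma$ exists and is $\sigma=\sigma_n\circ\sigma_{n-1}^{-1}$, where $\sigma_{n-1}$ is the analogous bijection of $\{1,\dots,n-1\}$ for $\Delta(\Gamma_{n-1})$. *)

(* Defs.v *)
From HB Require Import structures.
From mathcomp Require Import fingroup.
From mathcomp Require Import all_boot.
From mathcomp Require Import all_classical.

Set Implicit Arguments.
Unset Strict Implicit.
Unset Printing Implicit Defensive.

Local Open Scope quotient_scope.
Local Open Scope group_scope.

Section Presentation.
Variables (S : choiceType) (rels : seq S -> seq S -> Prop).

Inductive word_cong : seq S -> seq S -> Prop :=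
| WordCongRel u v of rels u v : word_cong u v
| WordCongRefl u : word_cong u u
| WordCongSym u v of word_cong u v : word_cong v u
| WordCongTrans v u w of word_cong u v & word_cong v w : word_cong u w
| WordCongCat u1 v1 u2 v2 of word_cong u1 v1 & word_cong u2 v2 :
    word_cong (u1 ++ u2) (v1 ++ v2).

Definition word_congb : rel (seq S) := fun u v => `[< word_cong u v >].

Fact word_congb_refl : reflexive word_congb.
Proof. by move=> u; apply/asboolP/WordCongRefl. Qed.

Fact word_congb_sym : symmetric word_congb.
Proof. by move=> u v; apply/asboolP/asboolP; apply: WordCongSym. Qed.

Fact word_congb_trans : transitive word_congb.
Proof.
by move=> v u w /asboolP uv /asboolP vw; apply/asboolP/(WordCongTrans uv vw).
Qed.

Canonical word_cong_equiv :=
  EquivRel word_congb word_congb_refl word_congb_sym word_congb_trans.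

(* The monoid < S | u = v for rels u v >. *)
Definition pres_monoid : Type := {eq_quot word_cong_equiv}.

HB.instance Definition _ := Choice.on pres_monoid.
HB.instance Definition _ := Quotient.on pres_monoid.

Definition word_class (w : seq S) : pres_monoid := \pi w.

Definition pres_gen (s : S) : pres_monoid := word_class [:: s].

Lemma word_classP u v : word_class u = word_class v <-> word_cong u v.
Proof.
split=> [/eqmodP/asboolP//|uv].
by apply/eqmodP/asboolP.
Qed.

Lemma word_class_repr (a : pres_monoid) : word_class (repr a) = a.
Proof. exact: reprK. Qed.

Definition pres_mul (a b : pres_monoid) := word_class (repr a ++ repr b).

Lemma pres_mulE u v :
  pres_mul (word_class u) (word_class v) = word_class (u ++ v).
Proof.
by apply/word_classP/WordCongCat; apply/word_classP; rewrite word_class_repr.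
Qed.

Fact pres_mulA : associative pres_mul.
Proof.
move=> a b c; rewrite -(word_class_repr a) -(word_class_repr b).
by rewrite -(word_class_repr c) !pres_mulE catA.
Qed.

Fact pres_mul1 : left_id (word_class [::]) pres_mul.
Proof. by move=> a; rewrite -(word_class_repr a) pres_mulE. Qed.

Fact pres_mulr1 : right_id (word_class [::]) pres_mul.
Proof. by move=> a; rewrite -(word_class_repr a) pres_mulE cats0. Qed.

HB.instance Definition _ :=
  isMonoid.Build pres_monoid pres_mulA pres_mul1 pres_mulr1.

Lemma word_class_cat u v : word_class (u ++ v) = word_class u * word_class v.
Proof. by rewrite -pres_mulE. Qed.

Lemma word_class_nil : word_class [::] = 1.
Proof. by []. Qed.

End Presentation.

Section Divisibility.
Variable M : monoidType.

Definition divides (a b : M) : Prop := exists l r : M, b = l * a * r.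

Definition ldivides (a b : M) : Prop := exists r : M, b = a * r.

End Divisibility.

(* A Coxeter matrix, equivalently a Coxeter graph: [cox_mx s t = None] stands
   for m_st = oo, and m_st = 2 means that s and t are not adjacent. *)
Record coxeter_graph (S : Type) := CoxeterGraph {
  cox_mx :> S -> S -> option nat;
  cox_mx_diag : forall s, cox_mx s s = Some 1%N;
  cox_mx_sym : forall s t, cox_mx s t = cox_mx t s;
  cox_mx_ge2 : forall s t m, s <> t -> cox_mx s t = Some m -> (2 <= m)%N
}.

Fixpoint alternating (S : Type) (s t : S) (m : nat) : seq S :=
  if m is m'.+1 then s :: alternating t s m' else [::].

Section ArtinCoxeter.
Variables (S : choiceType) (G : coxeter_graph S).

Inductive artin_rel : seq S -> seq S -> Prop :=
  ArtinRel s t m of s <> t & G s t = Some m :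
    artin_rel (alternating s t m) (alternating t s m).

Inductive coxeter_rel : seq S -> seq S -> Prop :=
| CoxeterBraid u v of artin_rel u v : coxeter_rel u v
| CoxeterSquare s : coxeter_rel [:: s; s] [::].

Definition artin_monoid : Type := pres_monoid artin_rel.
HB.instance Definition _ := Monoid.on artin_monoid.

Definition artin_gen (s : S) : artin_monoid := pres_gen artin_rel s.

(* Since every generator squares to 1, the monoid presented by
   [coxeter_rel] is the group with the same presentation. *)
Definition coxeter_group : Type := pres_monoid coxeter_rel.
HB.instance Definition _ := Monoid.on coxeter_group.

Definition coxeter_inv (a : coxeter_group) : coxeter_group :=
  word_class coxeter_rel (rev (repr a)).

Lemma word_class_rev_cat w :
  word_class coxeter_rel (rev w ++ w) = (1 : coxeter_group).
Proof.
elim: w => [//|s w IHw]; rewrite rev_cons cat_rcons.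
rewrite -[s :: s :: w]/([:: s; s] ++ w).
rewrite !word_class_cat.
have -> : word_class coxeter_rel [:: s; s] = word_class coxeter_rel [::].
  by apply/word_classP/WordCongRel/CoxeterSquare.
by rewrite -!word_class_cat.
Qed.

Fact coxeter_mulVg : left_inverse (1 : coxeter_group) coxeter_inv *%g.
Proof.
by move=> a; rewrite -{2}(word_class_repr a) -word_class_cat word_class_rev_cat.
Qed.

Fact coxeter_mulgV : right_inverse (1 : coxeter_group) coxeter_inv *%g.
Proof.
move=> a; rewrite -{1}(word_class_repr a) -word_class_cat.
by rewrite -{1}(revK (repr a)) word_class_rev_cat.
Qed.

HB.instance Definition _ := hasInv.Build coxeter_group coxeter_inv.
HB.instance Definition _ :=
  Monoid_isGroup.Build coxeter_group coxeter_mulVg coxeter_mulgV.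

Definition spherical : Prop := finite_set [set: coxeter_group].

Definition is_garside (D : artin_monoid) : Prop :=
  (forall s, ldivides (artin_gen s) D) /\
  (forall w : artin_monoid,
     (forall s, ldivides (artin_gen s) w) -> ldivides D w).

Lemma size_alternating (s t : S) m : size (alternating s t m) = m.
Proof. by elim: m s t => //= m IHm s t; rewrite IHm. Qed.

Lemma artin_size u v : word_cong artin_rel u v -> size u = size v.
Proof.
elim=> {u v} //= [u v [s t m _ _]|v u w _ -> _ ->//|u1 v1 u2 v2 _ e1 _ e2].
  by rewrite !size_alternating.
by rewrite !size_cat e1 e2.
Qed.

Lemma is_garside_uniq D1 D2 : is_garside D1 -> is_garside D2 -> D1 = D2.
Proof.
move=> [g1 m1] [g2 m2]; have [r def2] := m1 _ g2; have [q def1] := m2 _ g1.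
have size_mul (a b : artin_monoid) :
    size (repr (a * b)) = (size (repr a) + size (repr b))%N.
  rewrite -size_cat; apply/artin_size/word_classP.
  by rewrite word_class_repr word_class_cat !word_class_repr.
have: size (repr r) = 0%N.
  have := congr1 (fun a => size (repr a)) def1; rewrite size_mul.
  have := congr1 (fun a => size (repr a)) def2; rewrite size_mul.
  move=> -> /eqP; rewrite -addnA -{1}[size (repr D1)]addn0 eqn_add2l eq_sym.
  by rewrite addn_eq0 => /andP[/eqP].
move=> /size0nil r0.
by rewrite def2 -(word_class_repr r) r0 word_class_nil mulg1.
Qed.

End ArtinCoxeter.

Section Inclusion.
Variables (n : nat) (G' : coxeter_graph 'I_n) (G : coxeter_graph 'I_n.+1).

(* The vertices x_1, ..., x_(n+1) are 0, ..., n in 'I_n.+1; the vertex that is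
   not in the smaller graph is [ord_max]. *)
Definition vertex_incl (i : 'I_n) : 'I_n.+1 := widen_ord (leqnSn n) i.

Definition full_subgraph : Prop :=
  forall i j, G (vertex_incl i) (vertex_incl j) = G' i j.

(* The monoid morphism x_i |-> x_i; well defined by [artin_incl_class] when
   G' is a full subgraph of G. *)
Definition artin_incl (a : artin_monoid G') : artin_monoid G :=
  word_class (artin_rel G) (map vertex_incl (repr a)).

Hypothesis sGG' : full_subgraph.

Lemma vertex_incl_inj : injective vertex_incl.
Proof. by move=> i j /(congr1 val) /= /val_inj. Qed.

Lemma map_alternating i j m :
  map vertex_incl (alternating i j m) =
  alternating (vertex_incl i) (vertex_incl j) m.
Proof. by elim: m i j => //= m IHm i j; rewrite IHm. Qed.

Lemma word_cong_incl u v :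
  word_cong (artin_rel G') u v ->
  word_cong (artin_rel G) (map vertex_incl u) (map vertex_incl v).
Proof.
elim=> {u v} [u v [s t m st Gst]|u|u v _|u v w _ uv _ vw|u1 v1 u2 v2 _ c1 _ c2].
- rewrite !map_alternating; apply/WordCongRel/ArtinRel; last by rewrite sGG'.
  by move=> /vertex_incl_inj.
- exact: WordCongRefl.
- exact: WordCongSym.
- exact: WordCongTrans uv vw.
- by rewrite !map_cat; apply: WordCongCat.
Qed.

Lemma artin_incl_class w :
  artin_incl (word_class (artin_rel G') w) =
  word_class (artin_rel G) (map vertex_incl w).
Proof.
apply/word_classP/word_cong_incl.
by apply/word_classP; rewrite word_class_repr.
Qed.

Lemma artin_incl_gen i : artin_incl (artin_gen G' i) =
  artin_gen G (vertex_incl i).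
Proof. exact: artin_incl_class. Qed.

Lemma artin_incl_morph : monoid_morphism artin_incl.
Proof.
split=> [|a b]; first exact: (artin_incl_class [::]).
rewrite -(word_class_repr a) -(word_class_repr b) -word_class_cat.
by rewrite !artin_incl_class map_cat word_class_cat.
Qed.

End Inclusion.

(* Main.v *)
Require Import Defs.
From mathcomp Require Import fingroup.
From mathcomp Require Import all_boot.
From mathcomp Require Import ssralg ssrnum poly algC cyclotomic.
From mathcomp Require Import all_classical.
From mathcomp Require Import ring.

(** Write M for the Artin monoid of G, s, t for generators, P for the submonoid
generated by all generators but the last one, and Delta = D' R for the Garside
element.

The argument in M needs two facts: left cancellation, and the lcm property,
that an element divisible on the left by s <> t is divisible by the alternating
word of length m_st in s and t ([artin_cancel], [artin_resolves]).

First, D' U is divisible by every generator: by those of P because D' is, and by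
the last one because D' U = U tau(D') and U starts with it.  Hence Delta divides
D' U, and cancelling D' gives U = R V.  It remains to exclude V <> 1.  If V
starts with x_j and j <> m, then j = sigma(i) and R x_j = x_i R shows that U
starts with x_i in P, against [Ub].  If V starts with x_m, it is enough that R
ends in x_m, since then x_m^2 divides U, against [Ua].

For the last point, R <> 1 because D' does not involve the last generator.  Were
R = R1 x_j with j = sigma(i), then Delta = D' R = R sigma(D') = R1 x_j x_j ...,
as D' starts with x_i.  But Delta is square-free ([garside_square_free]): since
conjugation by Delta permutes the generators, a square inside Delta can be moved
to the front, Delta = s E with E starting with s; by the lcm property E then
starts with every other generator as well, so Delta divides the shorter E.

The two facts about M come from the finite Coxeter group W.  The parity of the
number of occurrences of a reflection in the list attached to a word only
depends on the class of the word in W, which gives the exchange condition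
([exchange]).  An explicit linear representation of W (the numbers game) shows
that st has order exactly m_st ([alternating_neq]).  Together they give the lcm
property inside W for reduced words, and the theorem of Matsumoto: reduced words
with the same class in W have the same class in M ([matsumoto]).  So in the set
of simple elements of M, the classes of reduced words, cancellation and the lcm
property hold, and since W is finite some simple element is divisible by all
generators.

The lcm property is carried over to all of M by induction on the length.  As the
congruence is generated by elementary moves, one has to compose s X = c Z and
c Z = t Y.  When s, c, t are distinct, Z is divisible by two simple elements that
both divide a simple g; by induction Z is divisible by a simple j below g that
both of them divide ([simple_join]).  Then c j is simple and starts with s and
with t, so the lcm property of simple elements applies to it
([resolves_trans]). *)

Set Implicit Arguments.
Unset Strict Implicit.
Unset Printing Implicit Defensive.

Import GRing.Theory Num.Theory.
Local Open Scope group_scope.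

(** * Reflections and the exchange condition *)

Lemma expg_swap (M : monoidType) (a b : M) k :
  a * (b * a) ^+ k = (a * b) ^+ k * a.
Proof.
elim: k => [|k IHk]; first by rewrite !expg0 mulg1 mul1g.
by rewrite !expgSr !mulgA IHk.
Qed.

Section Exchange.
Variables (S : choiceType) (G : coxeter_graph S).

Local Notation W := (coxeter_group G).
Definition cox_class (u : seq S) : W := word_class (coxeter_rel G) u.
Local Notation cls := cox_class.

Lemma cox_class_nil : cls [::] = 1.
Proof. by []. Qed.

Lemma cox_class_cat u v : cls (u ++ v) = cls u * cls v.
Proof. exact: word_class_cat. Qed.

Lemma cox_class_cons s u : cls (s :: u) = cls [:: s] * cls u.
Proof. exact: (cox_class_cat [:: s]). Qed.

Lemma cox_class_sq s : cls [:: s] * cls [:: s] = 1.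
Proof.
by rewrite -cox_class_cat; apply/word_classP/WordCongRel/CoxeterSquare.
Qed.

Lemma cox_class_invs s : (cls [:: s])^-1 = cls [:: s].
Proof. by apply: (mulgI (cls [:: s])); rewrite mulgV cox_class_sq. Qed.

Lemma cox_class_alt s t m : s <> t -> G s t = Some m ->
  cls (alternating s t m) = cls (alternating t s m).
Proof.
by move=> st Gst; apply/word_classP/WordCongRel/CoxeterBraid/ArtinRel.
Qed.

Lemma artin_coxeter u v : word_cong (artin_rel G) u v -> cls u = cls v.
Proof.
move=> uv; apply/word_classP; elim: uv => {u v} [u v r|u|u v _|u v w _ h _|].
- exact/WordCongRel/CoxeterBraid.
- exact: WordCongRefl.
- exact: WordCongSym.
- exact: WordCongTrans.
- by move=> u1 v1 u2 v2 _ c1 _; apply: WordCongCat.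
Qed.

Lemma cox_class_odd u v : cls u = cls v -> odd (size u) = odd (size v).
Proof.
move/word_classP; elim=> {u v} [u v [{}u {}v [s t m _ _]|s]|||u v w _ -> _ ->|] //.
  by rewrite !size_alternating.
by move=> u1 v1 u2 v2 _ c1 _ c2; rewrite !size_cat !oddD c1 c2.
Qed.

(** For u = s_1 ... s_k these are the elements s_1 ... s_i ... s_1 of W, so that
multiplying u on the left by the i-th one deletes s_i ([reflection_delete]). *)
Fixpoint reflections (u : seq S) : seq W :=
  if u is s :: u' then
    cls [:: s] :: [seq cls [:: s] * r * cls [:: s] | r <- reflections u']
  else [::].

Lemma reflections_cat u v : reflections (u ++ v) =
  reflections u ++ [seq cls u * r * (cls u)^-1 | r <- reflections v].
Proof.
elim: u => [|s u IHu] /=.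
  by rewrite -[LHS]map_id; apply: eq_map => r; rewrite cox_class_nil mul1g invg1 mulg1.
rewrite IHu map_cat -map_comp; congr (_ :: (_ ++ _)); apply: eq_map => r /=.
by rewrite (cox_class_cons s u) invMg cox_class_invs !mulgA.
Qed.

Lemma reflections_alt s t m : reflections (alternating s t m) =
  mkseq (fun i => (cls [:: s] * cls [:: t]) ^+ i * cls [:: s]) m.
Proof.
elim: m s t => [//|m IHm] s t /=; rewrite IHm /mkseq /= expg0 mul1g.
congr (_ :: _); rewrite -map_comp -[in RHS](addn0 1%N) iotaDl -map_comp.
apply: eq_map => i /=; rewrite add1n expgS !mulgA; congr (_ * _).
elim: i => [|i IHi]; first by rewrite !expg0 !mulg1.
by rewrite !expgSr !mulgA IHi -!mulgA.
Qed.

Definition inversion_parity u (r : W) := odd (count_mem r (reflections u)).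

Lemma inversion_parity_cat u v r : inversion_parity (u ++ v) r =
  inversion_parity u r (+) inversion_parity v ((cls u)^-1 * r * cls u).
Proof.
rewrite /inversion_parity reflections_cat count_cat oddD; congr (_ (+) odd _).
rewrite count_map; apply: eq_count => x /=; apply/eqP/eqP => [<-|->].
  by rewrite !mulgA mulVg mul1g mulgKV.
by rewrite !mulgA mulgV mul1g mulgK.
Qed.

(** Each letter deletes itself against the other word, so the two alternating
words of length k differ by the k-th power of st.  In particular the braid
relation of length m says that this power is 1 for k = m. *)
Lemma cox_class_altE s t k : cls (alternating s t k) =
  (cls [:: s] * cls [:: t]) ^+ k * cls (alternating t s k).
Proof.
elim: k s t => [|k IHk] s t; first by rewrite mul1g.
rewrite /= cox_class_cons IHk mulgA expg_swap expgSr.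
by rewrite (cox_class_cons t (alternating s t k)) -!mulgA (mulgA (cls [:: t]))
  cox_class_sq mul1g.
Qed.

(** The i-th reflection is (st)^i s on one side and (ts)^i t on the other, and
(ts)^(m-1-i) t = (st)^i s because (st)^m = 1. *)
Lemma reflections_braid s t m : s <> t -> G s t = Some m ->
  reflections (alternating s t m) = rev (reflections (alternating t s m)).
Proof.
move=> st Gst; rewrite !reflections_alt.
have := cox_class_altE s t m; rewrite (cox_class_alt st Gst).
set a := cls [:: s]; set b := cls [:: t].
move=> /(canLR (mulgK _)); rewrite mulgV => abm.
apply: (@eq_from_nth _ 1); first by rewrite size_rev !size_mkseq.
move=> i; rewrite size_mkseq => im.
rewrite nth_rev size_mkseq // !nth_mkseq ?ltn_subrL ?(leq_ltn_trans _ im) //.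
rewrite -/a -/b.
(* Both sides are inverse to b (ab)^(m-1-i), the right one being an involution. *)
apply: (mulIg (b * (a * b) ^+ (m - i.+1))).
have -> : (a * b) ^+ i * a * (b * (a * b) ^+ (m - i.+1)) = 1.
  by rewrite mulgA -(mulgA _ a b) -expgSr -expgD subnKC.
rewrite mulgA -(mulgA _ b b) cox_class_sq mulg1.
have -> : b * a = (a * b)^-1 by rewrite invMg !cox_class_invs.
by rewrite expVgn mulVg.
Qed.

(** A defining relation changes the list of reflections only by a permutation or
by a pair of equal entries, so the parity is a function on W. *)
Lemma inversion_parity_eq u v : cls u = cls v ->
  inversion_parity u =1 inversion_parity v.
Proof.
move/word_classP; elim=> {u v} [u v [{}u {}v [s t m st Gst]|s]||||] //.
- move=> r; rewrite /inversion_parity (reflections_braid st Gst).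
  by rewrite count_rev.
- move=> r; rewrite /inversion_parity /= cox_class_sq mul1g.
  by rewrite addn0 addnn odd_double.
- by move=> u v _ uv r; rewrite uv.
- by move=> u v w _ uv _ vw r; rewrite uv vw.
move=> u1 v1 u2 v2 c1 e1 _ e2 r; rewrite !inversion_parity_cat e1 e2.
by rewrite /cls; have/word_classP -> := c1.
Qed.

Definition reduced u := forall v, cls u = cls v -> size u <= size v.

Lemma reflection_delete u r : r \in reflections u ->
  exists p a q, u = p ++ a :: q /\ r * cls u = cls (p ++ q).
Proof.
elim: u r => [//|s u IHu] r /=; rewrite inE => /orP[/eqP ->|].
  exists [::], s, u; split=> //.
  by rewrite (cox_class_cons s u) mulgA cox_class_sq mul1g.
case/mapP=> r' /IHu [p [a [q [def_u ru]]]] ->.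
exists (s :: p), a, q; split; first by rewrite def_u.
rewrite (cox_class_cons s u) -!mulgA (mulgA _ _ (cls u)) cox_class_sq mul1g ru.
by rewrite -cox_class_cons.
Qed.

(** The reflection s occurs an odd number of times in the list of s v: once as the
first entry, and not in the part coming from v, since deleting the corresponding
letter of v would shorten s v.  By parity it also occurs in the list of u. *)
Lemma exchange s v u : reduced (s :: v) -> reduced u ->
    cls (s :: v) = cls u ->
  exists p a q, u = p ++ a :: q /\ cls v = cls (p ++ q).
Proof.
move=> red_sv red_u svu.
have: inversion_parity (s :: v) (cls [:: s]).
  rewrite -cat1s inversion_parity_cat cox_class_invs cox_class_sq mul1g.
  rewrite {1}/inversion_parity /= eqxx addn0 /inversion_parity.
  rewrite (_ : count_mem _ _ = 0%N) //; apply/count_memPn/negP.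
  move=> /reflection_delete[p [a [q [def_v]]]]; rewrite -cox_class_cons.
  move=> /red_sv; rewrite def_v /= !size_cat /= addnS => /ltnW.
  by rewrite ltnn.
rewrite (inversion_parity_eq svu) /inversion_parity => odd_u.
have: cls [:: s] \in reflections u.
  by rewrite -has_pred1 has_count; case: count odd_u.
move=> /reflection_delete[p [a [q [def_u su]]]]; exists p, a, q; split=> //.
by rewrite -su -svu (cox_class_cons s v) mulgA cox_class_sq mul1g.
Qed.

Lemma reduced_eq u v : reduced u -> cls u = cls v -> size u = size v -> reduced v.
Proof. by move=> red_u uv suv w vw; rewrite -suv red_u // uv. Qed.

Lemma reduced_size u v : reduced u -> reduced v -> cls u = cls v -> size u = size v.
Proof.
by move=> red_u red_v uv; apply/eqP; rewrite eqn_leq red_u ?red_v.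
Qed.

Lemma reduced_cat u v : reduced (u ++ v) -> reduced u /\ reduced v.
Proof.
move=> red_uv; split=> w eq_w.
  have := red_uv (w ++ v); rewrite !cox_class_cat eq_w !size_cat leq_add2r.
  exact.
have := red_uv (u ++ w); rewrite !cox_class_cat eq_w !size_cat leq_add2l.
exact.
Qed.

Lemma reduced_sq p s q : ~ reduced (p ++ s :: s :: q).
Proof.
move=> /(_ (p ++ q)); rewrite -[s :: s :: q]/([:: s; s] ++ q).
rewrite !cox_class_cat (cox_class_cons s [:: s]) cox_class_sq mul1g !size_cat /=.
by rewrite leq_add2l => /(_ erefl); rewrite ltnNge leqnSn.
Qed.

Lemma reduced_two_letters s t z : all (mem [:: s; t]) z -> reduced (s :: z) ->
  s :: z = alternating s t (size z).+1.
Proof.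
elim: z s t => [//|x z IHz] s t /= /andP[]; rewrite !inE.
move=> /orP[]/eqP-> all_z; first by move=> /(@reduced_sq [::]).
move=> /(@reduced_cat [:: s])[_ red_tz]; congr (_ :: _); apply: IHz red_tz.
by apply: sub_all all_z => y /=; rewrite !inE orbC.
Qed.

Lemma reduced_exists u : exists2 v, reduced v & cls u = cls v.
Proof.
have ex_n : exists n, `[< exists2 v, cls u = cls v & size v = n >].
  by exists (size u); apply/asboolP; exists u.
case: (ex_minnP ex_n) => n /asboolP[v uv size_v] min_n; exists v => // w vw.
by rewrite size_v; apply: min_n; apply/asboolP; exists w => //; rewrite uv.
Qed.

(** Lengths of words with equal class in W have the same parity, so that a
reduced word for s u has length size u - 1 when s u is not reduced. *)
Lemma reduced_descent s u : reduced u -> ~ reduced (s :: u) ->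
  exists2 v, reduced (s :: v) & cls (s :: v) = cls u.
Proof.
move=> red_u Nred_su; have [v red_v su_v] := reduced_exists (s :: u).
have sv_u : cls (s :: v) = cls u.
  by rewrite cox_class_cons -su_v (cox_class_cons s u) mulgA cox_class_sq mul1g.
exists v => //; apply: (reduced_eq red_u (esym sv_u)) => /=.
have le_vs : size v <= (size u).+1 by exact: (red_v (s :: u) (esym su_v)).
have ne_vs : size v != (size u).+1.
  by apply/eqP => eq_sz; apply: Nred_su; exact: reduced_eq red_v (esym su_v) eq_sz.
have := cox_class_odd sv_u => /= odd_vu.
apply/eqP; rewrite eqn_leq (red_u (s :: v) (esym sv_u)) /=.
move: le_vs; rewrite leq_eqVlt (negPf ne_vs) /= ltnS => le_vu.
rewrite ltn_neqAle le_vu andbT; apply/eqP => eq_vu; move: odd_vu.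
by rewrite eq_vu; case: odd.
Qed.

End Exchange.

(** * The order of a product of two generators *)

Section NumbersGame.
Variables (S : choiceType) (G : coxeter_graph S).
Local Open Scope ring_scope.

(** For o = Some m take a primitive 2m-th root of unity, and otherwise q = 2, which
has infinite order. *)
Lemma dihedral_root (o : option nat) : exists q : algC,
  [/\ q != 0,
      forall k, (0 < k)%N -> q ^+ k.*2 = 1 ->
        exists m, o = Some m /\ (m <= k)%N
    & forall m, o = Some m -> (2 <= m)%N -> q ^+ m = -1].
Proof.
have inf : forall k, (0 < k)%N -> 2%:R ^+ k.*2 = 1 :> algC -> False.
  move=> k k_gt0 /eqP; rewrite -natrX pnatr_eq1 => /eqP/(congr1 odd).
  by rewrite oddX /=; case: k k_gt0.
have q2 : (2%:R : algC) != 0 by rewrite pnatr_eq0.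
case: o => [m|]; last by exists 2%:R; split=> // k k_gt0 /(inf k k_gt0).
have [m0|] := posnP m.
  by exists 2%:R; split=> // [k k_gt0 /(inf k k_gt0)|_ [<-]] //; rewrite m0.
move=> m_gt0; have m2_gt0 : (0 < m.*2)%N by rewrite double_gt0.
have [q prim_q] := C_prim_root_exists m2_gt0; exists q; split.
- apply: contraTneq (oner_neq0 algC) => q0.
  by rewrite -(prim_expr_order prim_q) q0 expr0n gtn_eqF // eqxx.
- move=> k k_gt0 /eqP; rewrite -(prim_order_dvd prim_q) => m_dv_k.
  exists m; split=> //; rewrite -leq_double.
  by apply: dvdn_leq m_dv_k; rewrite double_gt0.
move=> _ [<-] _; have := prim_expr_order prim_q.
rewrite -muln2 exprM => /eqP; rewrite sqrf_eq1 => /orP[|/eqP//].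
rewrite -(prim_order_dvd prim_q) => /(dvdn_leq m_gt0).
by rewrite -addnn -{3}[m]addn0 leq_add2l leqNgt m_gt0.
Qed.

Variable q : option nat -> algC.

(** With q_st a primitive 2 m_st-th root of unity this is 2 cos(pi j / m_st), with
j prime to 2 m_st, for s <> t and a finite label. *)
Definition edge_weight s t : algC :=
  if t == s then - 2%:R else q (G s t) + (q (G s t))^-1.

Lemma edge_weight_diag s : edge_weight s s = - 2%:R.
Proof. by rewrite /edge_weight eqxx. Qed.

(** A move of the numbers game: W acts on functions on the graph, by the
contragredient of a geometric representation. *)
Definition fire s (p : S -> algC) : S -> algC :=
  fun u => p u + p s * edge_weight s u.

Definition play (w : seq S) p := foldl (fun p s => fire s p) p w.

(** Chebyshev polynomials of the second kind, normalised so that their value at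
z + 1/z is (z^k - z^-k) / (z - 1/z). *)
Fixpoint cheb (a : algC) k : algC :=
  if k is k'.+1 then (if k' is k''.+1 then a * cheb a k' - cheb a k'' else 1)
  else 0.

Lemma chebS a k : cheb a k.+2 = a * cheb a k.+1 - cheb a k.
Proof. by []. Qed.

Arguments cheb : simpl never.

Lemma chebE (z : algC) k : z != 0 ->
  cheb (z + z^-1) k * (z - z^-1) = z ^+ k - z ^- k.
Proof.
move=> z0.
have [] : cheb (z + z^-1) k * (z - z^-1) = z ^+ k - z ^- k /\
       cheb (z + z^-1) k.+1 * (z - z^-1) = z ^+ k.+1 - z ^- k.+1; last by [].
elim: k => [|k [IH0 IH1]].
  by rewrite mul0r expr0 invr1 subrr mul1r expr1.
split=> //; rewrite chebS mulrBl -mulrA IH1 IH0 -!exprVn.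
rewrite !exprS; set x := z ^+ k; set y := _ ^+ k; field.
exact: z0.
Qed.

(** The successive values that are fired satisfy the Chebyshev recurrence. *)
Lemma play_alternating s t k p u : s <> t ->
  let a := edge_weight s t in
  play (alternating s t k) p u = p u + \sum_(j < k)
    (cheb a j.+1 * p s + cheb a j * p t) * edge_weight (if odd j then t else s) u.
Proof.
elim: k s t p => [|k IHk] s t p st /=; first by rewrite big_ord0 addr0.
have ets : edge_weight t s = edge_weight s t.
  by rewrite /edge_weight cox_mx_sym eq_sym.
rewrite IHk; last exact: nesym.
rewrite big_ord_recl /= addrA; congr (_ + _); first by rewrite /fire /cheb; ring.
apply: eq_bigr => j _; rewrite ets /bump/= !add1n add0n chebS /fire edge_weight_diag.
by case: odd => /=; ring.
Qed.

(** The difference of the two sums of [play_alternating] telescopes, because the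
letter fired next in one word is the letter fired now in the other. *)
Lemma play_braid s t k p u : s <> t ->
  let a := edge_weight s t in
  play (alternating s t k) p u - play (alternating t s k) p u =
  cheb a k * (p s * edge_weight (if odd k then s else t) u
            - p t * edge_weight (if odd k then t else s) u).
Proof.
move=> st a; have ets : edge_weight t s = a.
  by rewrite /a /edge_weight cox_mx_sym eq_sym.
rewrite !play_alternating //; last exact: nesym.
rewrite ets -/a opprD addrACA subrr add0r -sumrB.
elim: k => [|k IHk]; first by rewrite big_ord0 mul0r.
rewrite big_ord_recr /= {}IHk; case: odd => /=.
  ring.
ring.
Qed.

Hypothesis q_neq0 : forall o, q o != 0.
Hypothesis q_order : forall o k, (0 < k)%N -> q o ^+ k.*2 = 1 ->
  exists m, o = Some m /\ (m <= k)%N.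
Hypothesis q_pow : forall o m, o = Some m -> (2 <= m)%N -> q o ^+ m = -1.

Lemma cheb_eq0 s t k : s <> t -> (0 < k)%N -> cheb (edge_weight s t) k = 0 ->
  exists m, G s t = Some m /\ (m <= k)%N.
Proof.
move=> st k_gt0 ck; apply: (q_order k_gt0).
have := chebE k (q_neq0 (G s t)); move: ck; rewrite /edge_weight.
case: eqP => [/esym//|_ ->]; rewrite mul0r => /esym/eqP; rewrite subr_eq0.
move=> /eqP qk; rewrite -addnn exprD {1}qk mulVf //.
by rewrite expf_neq0 ?q_neq0.
Qed.

Lemma cheb_order s t m : s <> t -> G s t = Some m ->
  cheb (edge_weight s t) m = 0.
Proof.
move=> st Gst; have m_ge2 := cox_mx_ge2 st Gst.
have := chebE m (q_neq0 (G s t)); rewrite (q_pow Gst m_ge2) invrN1 subrr.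
move=> /eqP; rewrite /edge_weight; case: (t =P s) => [/esym//|_].
rewrite mulf_eq0 => /orP[/eqP//|]; rewrite subr_eq0 => /eqP qq.
have := @q_order (G s t) 1 isT; rewrite expr2 {2}qq mulfV //.
move=> /(_ erefl)[m' []]; rewrite Gst => -[<-].
by rewrite leqNgt m_ge2.
Qed.

Lemma play_cat u v p : play (u ++ v) p = play v (play u p).
Proof. exact: foldl_cat. Qed.

Lemma play_cong u v : word_cong (coxeter_rel G) u v -> play u =1 play v.
Proof.
elim=> {u v} [u v [{}u {}v [s t m st Gst]|s] p|||u v w _ uv _ vw p|] //.
- apply/funext => x; apply/eqP; rewrite -subr_eq0 play_braid //.
  by rewrite (cheb_order st Gst) mul0r.
- apply/funext => x; rewrite /= /fire edge_weight_diag.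
  by rewrite mulrN mulr_natr mulr2n opprD addNKr mulNr addrK.
- by move=> u v _ uv p; rewrite uv.
- by rewrite uv vw.
by move=> u1 v1 u2 v2 _ e1 _ e2 p; rewrite !play_cat e1 e2.
Qed.

End NumbersGame.

(** The state with value 1 at s and 0 elsewhere separates the two words unless the
k-th Chebyshev value vanishes, that is, unless q_st^(2k) = 1. *)
Lemma alternating_neq (S : choiceType) (G : coxeter_graph S) s t k :
    s <> t -> (0 < k)%N ->
    cox_class G (alternating s t k) = cox_class G (alternating t s k) ->
  exists m, G s t = Some m /\ (m <= k)%N.
Proof.
move=> st k_gt0 /word_classP alt_st.
have [q q_prop] := choice dihedral_root.
have q0 o : q o != 0%R by case: (q_prop o).
have q1 o k' (h : (0 < k')%N) := let: And3 _ h' _ := q_prop o in h' k' h.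
have q2 o := let: And3 _ _ h := q_prop o in h.
apply: (cheb_eq0 q0 q1 st k_gt0).
pose p x : algC := ((x == s)%:R)%R.
pose x := if odd k then s else t.
have := play_braid G q k p x st; rewrite (play_cong q0 q1 q2 alt_st) subrr.
rewrite /p eqxx; case: eqP => [/esym//|_].
rewrite mul1r mul0r subr0 -/x /edge_weight eqxx => /esym/eqP.
by rewrite mulf_eq0 oppr_eq0 pnatr_eq0 orbF => /eqP.
Qed.

(** * Matsumoto's theorem *)

Lemma cat_eq_prefix (T : Type) (x y z w : seq T) : x ++ y = z ++ w ->
  size z <= size x -> exists q, x = z ++ q /\ w = q ++ y.
Proof.
elim: z x => [|a z IHz] [|b x] //=; first by exists [::].
  by move=> <- _; exists (b :: x).
by move=> [-> /IHz h] /h[q [-> ->]]; exists q.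
Qed.

Section Matsumoto.
Variables (S : choiceType) (G : coxeter_graph S).
Local Notation cls := (cox_class G).
Local Notation reduced := (reduced G).

Lemma mem_alternating (s t : S) k : all (mem [:: s; t]) (alternating s t k).
Proof.
elim: k s t => [//|k IHk] s t /=; rewrite !inE eqxx /=.
by apply: sub_all (IHk t s) => y /=; rewrite !inE orbC.
Qed.

(** Induction on k, with s and t exchanged: if t s t ... (k letters) is a prefix of
a word for the same element, exchange with s deletes a letter of that word.
If this letter is after the prefix, the prefix grows to s t s ... (k+1 letters).
Otherwise s t s ... and t s t ... with k < m_st letters agree in W, which is
impossible. *)
Lemma alternating_prefix s t v v' k : s <> t -> reduced (s :: v) ->
    cls (s :: v) = cls (t :: v') -> size v = size v' ->
    (forall m, G s t = Some m -> k <= m) ->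
  exists r, reduced (alternating s t k ++ r) /\
    cls (alternating s t k ++ r) = cls (s :: v).
Proof.
elim: k s t v v' => [|k IHk] s t v v' st red_sv sv_tv' sz_v le_km.
  by exists (s :: v).
have red_tv' : reduced (t :: v').
  by apply: (reduced_eq red_sv sv_tv'); rewrite /= sz_v.
have [|r [red_r cls_r]] := IHk t s v' v (nesym st) red_tv' (esym sv_tv') (esym sz_v).
  by move=> m; rewrite cox_mx_sym => /le_km/ltnW.
have [p [a [q [def_r cls_v]]]] := exchange red_sv red_r (etrans sv_tv' (esym cls_r)).
have sz_r := reduced_size red_sv red_r (etrans sv_tv' (esym cls_r)).
have [le_kp|lt_pk] := leqP k (size p).
  have [p' [def_p def_r']] : exists p', p = alternating t s k ++ p' /\ r = p' ++ a :: q.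
    by apply: cat_eq_prefix (esym def_r) _; rewrite size_alternating.
  have cls_v' : cls (s :: v) = cls (alternating s t k.+1 ++ p' ++ q).
    by rewrite cox_class_cons cls_v -cox_class_cons def_p -catA.
  exists (p' ++ q); split=> //; apply: (reduced_eq red_sv cls_v').
  by rewrite sz_r def_r' /= !size_cat /= !size_alternating !addnS.
have [q' [alt_pq def_q]] : exists q',
    alternating t s k = rcons p a ++ q' /\ q = q' ++ r.
  apply: cat_eq_prefix; first by rewrite def_r cat_rcons.
  by rewrite size_rcons size_alternating.
rewrite cat_rcons in alt_pq.
have red_alt : reduced (alternating t s k) by have [] := reduced_cat red_r.
have k_gt0 : 0 < k by apply: leq_ltn_trans lt_pk.
have cls_del : cls (alternating t s k) = cls (s :: p ++ q').
  apply: (mulIg (cls r)); rewrite -!cox_class_cat cls_r -sv_tv'.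
  by rewrite cox_class_cons cls_v -cox_class_cons def_q catA.
have sz_del : size (alternating t s k) = size (s :: p ++ q').
  by rewrite alt_pq /= !size_cat /= addnS.
have red_del := reduced_eq red_alt cls_del sz_del.
have del_alt : s :: p ++ q' = alternating s t k.
  rewrite (@reduced_two_letters _ G s t) //.
    by have -> : (size (p ++ q')).+1 = k by rewrite -[RHS](size_alternating t s) sz_del.
  have /allP alt_mem := mem_alternating t s k.
  apply/allP => x x_pq; have := alt_mem x; rewrite alt_pq.
  rewrite !mem_cat !inE orbCA -mem_cat x_pq orbT orbC; exact.
have [m [Gst /leq_ltn_trans le_mk]] : exists m, G s t = Some m /\ m <= k.
  by apply: alternating_neq st k_gt0 _; rewrite cls_del del_alt.
by have := le_mk _ (le_km _ Gst); rewrite ltnn.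
Qed.

(** The label of s and t is finite, as otherwise there would be alternating
prefixes longer than the word itself. *)
Lemma two_descents s t v v' : s <> t -> reduced (s :: v) -> reduced (t :: v') ->
    cls (s :: v) = cls (t :: v') ->
  exists m r, [/\ G s t = Some m.+1,
    reduced (alternating t s m ++ r) /\ cls v = cls (alternating t s m ++ r) &
    reduced (alternating s t m ++ r) /\ cls v' = cls (alternating s t m ++ r)].
Proof.
move=> st red_sv red_tv' sv_tv'.
have [sz_v] := reduced_size red_sv red_tv' sv_tv'.
case Gst: (G s t) => [m|]; last first.
  have [|r [red_r cls_r]] := @alternating_prefix s t v v' (size v).+2
    st red_sv sv_tv' sz_v.
    by move=> m; rewrite Gst.
  have := reduced_size red_r red_sv cls_r.
  rewrite size_cat size_alternating /= => /eqP.
  by rewrite addSn eqSS gtn_eqF // leq_addr.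
have [|r [red_r cls_r]] := @alternating_prefix s t v v' m st red_sv sv_tv' sz_v.
  by move=> m'; rewrite Gst => -[->].
have := cox_mx_ge2 st Gst; case: m Gst red_r cls_r => // m Gst red_r cls_r _.
exists m, r; have alt_st := cox_class_alt st Gst.
have red_r' : reduced (alternating t s m.+1 ++ r).
  apply: (reduced_eq red_r); first by rewrite !cox_class_cat alt_st.
  by rewrite !size_cat !size_alternating.
split=> //; split.
- by have [] := @reduced_cat _ _ [:: s] _ red_r.
- by apply: (mulgI (cls [:: s])); rewrite -!cox_class_cons -cls_r.
- by have [] := @reduced_cat _ _ [:: t] _ red_r'.
apply: (mulgI (cls [:: t])); rewrite -!cox_class_cons -sv_tv' -cls_r.
by rewrite -[t :: _]/(alternating t s m.+1 ++ r) !cox_class_cat alt_st.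
Qed.

Lemma word_cong_cons s u v : word_cong (artin_rel G) u v ->
  word_cong (artin_rel G) (s :: u) (s :: v).
Proof.
by move=> uv; apply: (@WordCongCat _ _ [:: s] [:: s]) uv; apply: WordCongRefl.
Qed.

Theorem matsumoto u v : reduced u -> reduced v -> cls u = cls v ->
  word_cong (artin_rel G) u v.
Proof.
have [n] := ubnP (size u).
elim: n u v => // n IHn [|s u] [|t v] //= lt_un red_u red_v uv.
- exact: WordCongRefl.
- by have := reduced_size red_u red_v uv.
- by have := reduced_size red_u red_v uv.
(* When the first letters differ, pass through the two words that start with the
   two sides of the braid relation of s and t. *)
have [_ red_u1] := @reduced_cat _ _ [:: s] _ red_u.
have [_ red_v1] := @reduced_cat _ _ [:: t] _ red_v.
have [sz_uv] := reduced_size red_u red_v uv.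
have [eq_st|st] := eqVneq s t.
  rewrite -{t}eq_st in uv red_v red_v1 *.
  apply/word_cong_cons/IHn => //.
  by apply: (mulgI (cls [:: s])); rewrite -!cox_class_cons.
have [m [r [Gst [red_r cls_r] [red_r' cls_r']]]] :=
  two_descents (elimN eqP st) red_u red_v uv.
apply: (@WordCongTrans _ _ (alternating s t m.+1 ++ r)).
  exact/word_cong_cons/IHn.
apply: (@WordCongTrans _ _ (alternating t s m.+1 ++ r)).
  apply: WordCongCat (WordCongRefl _ _); apply/WordCongRel/ArtinRel => //.
  exact/eqP.
by apply/word_cong_cons/WordCongSym/IHn => //; rewrite -sz_uv.
Qed.

(** A reduced word of maximal length exists as W is finite; no letter can be added
in front of it, so that each generator is a descent. *)
Lemma longest_word : spherical G -> exists w, reduced w /\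
  forall s, exists2 v, reduced (s :: v) & cls (s :: v) = cls w.
Proof.
move=> /finite_seqP[l def_l].
pose P n := `[< exists2 w, reduced w & size w = n >].
have ex_P : exists n, P n.
  by have [w red_w _] := reduced_exists G [::]; exists (size w);
    apply/asboolP; exists w.
have bound_P n : P n -> n <= \max_(x <- l) size (repr x).
  move=> /asboolP[w red_w <-].
  have w_l : cls w \in l by have : ([set` l] (cls w))%classic by rewrite -def_l.
  rewrite (big_rem _ w_l) /= leq_max; apply/orP; left; apply: red_w.
  by rewrite /cox_class word_class_repr.
case: (ex_maxnP ex_P bound_P) => n /asboolP[w red_w sz_w] max_n.
exists w; split=> // s; apply: reduced_descent => // red_sw.
suff: size w < size w by rewrite ltnn.
by rewrite {2}sz_w; apply: max_n; apply/asboolP; exists (s :: w).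
Qed.

End Matsumoto.

(** * Cancellation and lcms in the Artin monoid *)

Section ArtinMonoid.
Variables (S : choiceType) (G : coxeter_graph S).
Local Notation M := (artin_monoid G).
Local Notation cls := (cox_class G).
Local Notation gen := (artin_gen G).
Local Notation reduced := (reduced G).

Definition artin_class (u : seq S) : M := word_class (artin_rel G) u.
Local Notation art := artin_class.

Lemma artin_class_cat u v : art (u ++ v) = art u * art v.
Proof. exact: word_class_cat. Qed.

Lemma artin_class_cons s u : art (s :: u) = gen s * art u.
Proof. exact: (artin_class_cat [:: s]). Qed.

Lemma artin_class_nil : art [::] = 1.
Proof. by []. Qed.

Lemma artin_classW (a : M) : exists u, a = art u.
Proof. by exists (repr a); rewrite /artin_class word_class_repr. Qed.

Lemma artin_class_braid s t m : s <> t -> G s t = Some m ->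
  art (alternating s t m) = art (alternating t s m).
Proof. by move=> st Gst; apply/word_classP/WordCongRel/ArtinRel. Qed.

Definition artin_length (a : M) := size (repr a).
Local Notation len := artin_length.

Lemma artin_length_class u : len (art u) = size u.
Proof. by apply/(@artin_size _ G)/word_classP; exact: word_class_repr. Qed.

Lemma artin_lengthM a b : len (a * b) = len a + len b.
Proof.
have [[u ->] [v ->]] := (artin_classW a, artin_classW b).
by rewrite -artin_class_cat !artin_length_class size_cat.
Qed.

Lemma artin_length_gen s : len (gen s) = 1%N.
Proof. exact: (artin_length_class [:: s]). Qed.

Lemma artin_genW a : a = 1 \/ exists s b, a = gen s * b.
Proof.
have [[|s u] ->] := artin_classW a; first by left.
by right; exists s, (art u); rewrite artin_class_cons.
Qed.

Definition simple (a : M) := reduced (repr a).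

Lemma simple_class u : simple (art u) <-> reduced u.
Proof.
have cong_u : word_cong (artin_rel G) (repr (art u)) u.
  by apply/word_classP; exact: word_class_repr.
have [eq_cls eq_size] := (artin_coxeter cong_u, artin_size cong_u).
by split=> red; apply: (reduced_eq red).
Qed.

Lemma simpleM a b : simple (a * b) -> simple a /\ simple b.
Proof.
have [[u ->] [v ->]] := (artin_classW a, artin_classW b).
by rewrite -artin_class_cat !simple_class => /reduced_cat.
Qed.

(** The conclusion of the cancellation and lcm properties for s X = t Y, where the
label m_st is written m+1. *)
Definition resolves s (X : M) t (Y : M) :=
  (s = t /\ X = Y) \/ (s <> t /\ exists m V, [/\ G s t = Some m.+1,
     X = art (alternating t s m) * V & Y = art (alternating s t m) * V]).

Lemma resolves_sym s X t Y : resolves s X t Y -> resolves t Y s X.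
Proof.
case=> [[-> ->]|[st [m [V [Gst -> ->]]]]]; first by left.
right; split; first exact: nesym.
by exists m, V; rewrite cox_mx_sym.
Qed.

Lemma resolvesM s X t Y Z : resolves s X t Y -> resolves s (X * Z) t (Y * Z).
Proof.
case=> [[-> ->]|[st [m [V [Gst -> ->]]]]]; first by left.
by right; split=> //; exists m, (V * Z); rewrite !mulgA.
Qed.

(** For simple elements equality in M is equality in W, where cancellation is free
and the lcm property is [two_descents]. *)
Lemma simple_resolves s X t Y : simple (gen s * X) -> gen s * X = gen t * Y ->
  resolves s X t Y.
Proof.
have [[u ->] [v ->]] := (artin_classW X, artin_classW Y).
rewrite -!artin_class_cons => simp_sX sX_tY.
have red_su : reduced (s :: u) by apply/simple_class.
have red_tv : reduced (t :: v) by apply/simple_class; rewrite -sX_tY.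
have su_tv : cls (s :: u) = cls (t :: v) by apply/artin_coxeter/word_classP.
have [_ red_u] := @reduced_cat _ _ [:: s] _ red_su.
have [_ red_v] := @reduced_cat _ _ [:: t] _ red_tv.
have [eq_st|st] := pselect (s = t).
  rewrite -eq_st in su_tv *; left; split=> //.
  apply/word_classP/matsumoto => //.
  by apply: (mulgI (cls [:: s])); rewrite -!cox_class_cons.
right; split=> //.
have [m [r [Gst [red_r cls_r] [red_r' cls_r']]]] :=
  two_descents st red_su red_tv su_tv.
exists m, (art r); rewrite -!artin_class_cat.
by split=> //; apply/word_classP/matsumoto.
Qed.

(** The induction hypothesis on the length: it concerns the equal elements s X of
length at most l. *)
Definition lcm_below l := forall s t X Y, len X < l ->
  gen s * X = gen t * Y -> resolves s X t Y.

Lemma resolves_cancel s X Y : resolves s X s Y -> X = Y.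
Proof. by case=> [[]|[]]. Qed.

Lemma lcm_below_cancel l a X Y : lcm_below l -> len (a * X) <= l ->
  a * X = a * Y -> X = Y.
Proof.
move=> lcm_l; have [u ->] := artin_classW a.
elim: u => [|s u IHu]; first by rewrite artin_class_nil !mul1g.
rewrite artin_class_cons -!mulgA artin_lengthM artin_length_gen add1n => lt_l.
by move=> /lcm_l -/(_ lt_l)/resolves_cancel; apply/IHu/ltnW.
Qed.

Lemma ldivides_refl (a : M) : ldivides a a.
Proof. by exists 1; rewrite mulg1. Qed.

Lemma ldivides1 (a : M) : ldivides 1 a.
Proof. by exists a; rewrite mul1g. Qed.

Lemma ldividesM (a b c : M) : ldivides b c -> ldivides (a * b) (a * c).
Proof. by case=> r ->; exists r; rewrite mulgA. Qed.

Lemma ldivides_trans (b a c : M) : ldivides a b -> ldivides b c -> ldivides a c.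
Proof. by case=> r -> [r' ->]; exists (r * r'); rewrite mulgA. Qed.

Lemma ldividesMr (a b c : M) : ldivides a b -> ldivides a (b * c).
Proof. by case=> r ->; exists (r * c); rewrite mulgA. Qed.

Lemma simple_cancel s X Y : simple (gen s * X) -> gen s * X = gen s * Y -> X = Y.
Proof. by move=> simp_sX /(simple_resolves simp_sX)/resolves_cancel. Qed.

(** A common multiple j of x and y that works for every Z of length at most l is
built inside g by induction on the length of g.  If x = s x' and y = t y' with
s <> t, let w = s u = t v be the lcm of s and t, which divides g and each Z.
Joining x' with u below g/s and y' with v below g/t gives s i1 and t i2; both are
multiples of w, so t i2 is also a multiple of s, and a third join below g/s
combines the two. *)
Lemma simple_join l (g x y : M) : lcm_below l ->
    simple g -> ldivides x g -> ldivides y g ->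
  exists j, [/\ ldivides j g, ldivides x j, ldivides y j &
    forall Z, len Z <= l -> ldivides x Z -> ldivides y Z -> ldivides j Z].
Proof.
move=> lcm_l; have [n] := ubnP (len g); elim: n => // n IHn in g x y *.
move=> lt_gn simp_g x_g y_g.
have [->|[s [x' def_x]]] := artin_genW x.
  by exists y; split=> //; [exact: ldivides1 | exact: ldivides_refl].
have [->|[t [y' def_y]]] := artin_genW y.
  by exists x; split=> //; [exact: ldivides_refl | exact: ldivides1].
move: x_g y_g; rewrite {}def_x {}def_y => -[r1 def_g] [r2 def_g'].
rewrite -!mulgA in def_g def_g'; move: simp_g lt_gn.
have tail_lt u (X : M) : g = gen u * X -> len g < n.+1 -> len X < n.
  by move=> ->; rewrite artin_lengthM artin_length_gen.
rewrite {1}def_g => simp_sg lt_gn.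
have simp_tg : simple (gen t * (y' * r2)) by rewrite -def_g' def_g.
have lt_n1 := tail_lt _ _ def_g lt_gn; have lt_n2 := tail_lt _ _ def_g' lt_gn.
have [_ simp1] := simpleM simp_sg; have [_ simp2] := simpleM simp_tg.
have x'_g1 : ldivides x' (x' * r1) by exists r1.
have y'_g2 : ldivides y' (y' * r2) by exists r2.
have := simple_resolves simp_sg (etrans (esym def_g) def_g').
have lt_tail u X Z : Z = gen u * X -> len Z <= l -> len X < l.
  by move=> ->; rewrite artin_lengthM artin_length_gen.
case=> [[eq_st eq_g]|[st [m [V [Gst eq_g1 eq_g2]]]]].
  rewrite -eq_st in def_g' simp_tg *.
  have y'_g1 : ldivides y' (x' * r1) by rewrite eq_g.
  have [j [j_g x_j y_j jP]] := IHn _ x' y' lt_n1 simp1 x'_g1 y'_g1.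
  exists (gen s * j); split; try exact: ldividesM.
    by rewrite def_g; exact: ldividesM.
  move=> Z le_Zl [r] def_Z [r']; rewrite {1}def_Z -!mulgA => eq_Z.
  rewrite -mulgA in def_Z.
  have lt_Zl := lt_tail _ _ _ def_Z le_Zl.
  have eq_r := resolves_cancel (lcm_l _ _ _ _ lt_Zl eq_Z).
  rewrite def_Z; apply/ldividesM/jP; first exact: ltnW.
    by exists r.
  by exists r'.
set u := art (alternating t s m) in eq_g1; set v := art (alternating s t m) in eq_g2.
have su_tv : gen s * u = gen t * v.
  by rewrite -!artin_class_cons; exact: (@artin_class_braid s t m.+1).
have u_g1 : ldivides u (x' * r1) by exists V.
have v_g2 : ldivides v (y' * r2) by exists V.
have [i1 [i1_g x_i1 u_i1 i1P]] := IHn _ x' u lt_n1 simp1 x'_g1 u_g1.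
have [i2 [[r' i2_g] y_i2 [i2'' def_i2] i2P]] := IHn _ y' v lt_n2 simp2 y'_g2 v_g2.
have i2_s : gen t * i2 = gen s * (u * i2'') by rewrite def_i2 !mulgA su_tv.
have i2_g1 : ldivides (u * i2'') (x' * r1).
  exists r'; apply: (simple_cancel simp_sg).
  by rewrite -def_g def_g' i2_g !mulgA i2_s !mulgA.
have [j [j_g i1_j i2_j jP]] := IHn _ i1 (u * i2'') lt_n1 simp1 i1_g i2_g1.
exists (gen s * j); split.
- by rewrite def_g; apply: ldividesM.
- exact/ldividesM/(ldivides_trans x_i1).
- apply: (@ldivides_trans (gen t * i2)); first exact: ldividesM.
  by rewrite i2_s; exact: ldividesM.
move=> Z le_Zl [rx def_Z] [ry def_Z']; rewrite -!mulgA in def_Z def_Z'.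
have lt_Z1 := lt_tail _ _ _ def_Z le_Zl.
have lt_Z2 := lt_tail _ _ _ def_Z' le_Zl.
case: (lcm_l _ _ _ _ lt_Z1 (etrans (esym def_Z) def_Z')) => [[]//|].
case=> _ [m' [V' []]]; rewrite Gst => -[<-] eq_Z1 eq_Z2.
have [||r2' def_r2'] := i2P (y' * ry) (ltnW lt_Z2); first by exists ry.
  by exists V'.
rewrite def_Z; apply/ldividesM/jP; first exact: ltnW.
  apply: i1P; first exact: ltnW.
    by exists rx.
  by exists V'.
exists r2'; apply: (@lcm_below_cancel l (gen s)) => //; first by rewrite -def_Z.
by rewrite -def_Z def_Z' def_r2' !mulgA i2_s !mulgA.
Qed.

Hypothesis sphG : spherical G.

Lemma longest_simple : exists2 w : M, simple w & forall s, ldivides (gen s) w.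
Proof.
have [w [red_w desc_w]] := longest_word sphG.
exists (art w); first exact/simple_class.
move=> s; have [v red_sv sv_w] := desc_w s.
by exists (art v); rewrite -artin_class_cons; apply/word_classP/matsumoto.
Qed.

(** When s, c, t are distinct, Z is divisible by x and y, where c x and c y are the
lcms of c with s and with t.  Both c x and c y divide a longest simple element
c g, so [simple_join] gives j | Z with x, y | j | g.  The simple element c j is
divisible by s and t, and the lcm property of s X = t Y follows from that of c j
by right multiplication. *)
Lemma resolves_trans c Z s X t Y : lcm_below (len Z) -> len X = len Z ->
  resolves s X c Z -> resolves c Z t Y -> resolves s X t Y.
Proof.
move=> lcm_Z len_XZ; case=> [[-> ->]//|[sc [m1 [V1 [Gsc def_X def_Z]]]]].
case=> [[<- <-]|[ct [m2 [V2 [Gct def_Z' def_Y]]]]].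
  by right; split=> //; exists m1, V1.
have [eq_st|st] := pselect (s = t).
  rewrite -eq_st in Gct def_Z' def_Y *; left; split=> //.
  move: Gct; rewrite cox_mx_sym Gsc => -[eq_m]; rewrite -eq_m in def_Z' def_Y.
  rewrite def_X def_Y; congr (_ * _).
  apply: (@lcm_below_cancel (len Z) (art (alternating s c m1))) => //.
    by rewrite -def_Z.
  by rewrite -def_Z -def_Z'.
have [w simp_w w_all] := longest_simple.
have [g def_w] := w_all c.
have w_pref x m : c <> x -> G c x = Some m.+1 -> ldivides (art (alternating x c m)) g.
  move=> cx Gcx; have [g' def_w'] := w_all x.
  have simp_cg : simple (gen c * g) by rewrite -def_w.
  have := simple_resolves simp_cg (etrans (esym def_w) def_w').
  case=> [[]//|[_ [m' [V []]]]]; rewrite Gcx => -[<-] -> _.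
  by exists V.
have [_ simp_g] : simple (gen c) /\ simple g by apply: simpleM; rewrite -def_w.
have x_g : ldivides (art (alternating s c m1)) g.
  by apply: w_pref; [exact: nesym | rewrite cox_mx_sym].
have y_g := w_pref t m2 ct Gct.
have [j [[rj def_g] [j1 def_j1] [j2 def_j2] jP]] := simple_join lcm_Z simp_g x_g y_g.
have [||Z' def_Zj] := jP Z (leqnn _); first by exists V1.
  by exists V2.
have def_V1 : V1 = j1 * Z'.
  apply: (@lcm_below_cancel (len Z) (art (alternating s c m1))) => //.
    by rewrite -def_Z.
  by rewrite -def_Z mulgA -def_j1.
have def_V2 : V2 = j2 * Z'.
  apply: (@lcm_below_cancel (len Z) (art (alternating t c m2))) => //.
    by rewrite -def_Z'.
  by rewrite -def_Z' mulgA -def_j2.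
have [simp_cj _] : simple (gen c * j) /\ simple rj.
  by apply: simpleM; rewrite -mulgA -def_g -def_w.
have cj_s : gen c * j = gen s * (art (alternating c s m1) * j1).
  rewrite def_j1 !mulgA -!artin_class_cons; congr (_ * _).
  by apply: (@artin_class_braid c s m1.+1); [exact: nesym | rewrite cox_mx_sym].
have cj_t : gen c * j = gen t * (art (alternating c t m2) * j2).
  rewrite def_j2 !mulgA -!artin_class_cons; congr (_ * _).
  exact: (@artin_class_braid c t m2.+1).
have simp_s : simple (gen s * (art (alternating c s m1) * j1)) by rewrite -cj_s.
have := simple_resolves simp_s (etrans (esym cj_s) cj_t).
rewrite def_X def_Y def_V1 def_V2 !mulgA; exact: resolvesM.
Qed.

(** The property is read off two congruent words by their first letters; along the
rules that generate the congruence only transitivity is not immediate. *)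
Theorem artin_resolves s X t Y : gen s * X = gen t * Y -> resolves s X t Y.
Proof.
have [l] := ubnP (len X); elim: l s t X Y => // l IHl.
have lcm_l : lcm_below l by move=> s t X Y; apply: IHl.
suff resolves_l u v : word_cong (artin_rel G) u v -> size u <= l.+1 ->
    match u, v with
    | s :: u', t :: v' => resolves s (art u') t (art v')
    | _, _ => True
    end.
  move=> s t X Y; have [[u ->] [v ->]] := (artin_classW X, artin_classW Y).
  rewrite artin_length_class -!artin_class_cons => lt_ul /word_classP/resolves_l.
  exact.
elim=> {u v} [u v [s t [|m] st Gst]|[|s u]|u v uv IH|u v w uv IHu vw IHv|] //.
- move=> _; right; split=> //; exists m, 1.
  by rewrite Gst !mulg1.
- by move=> _; left.
- rewrite -(artin_size uv) => /IH.
  by case: u v {uv IH} => [|s u] [|t v] //; exact: resolves_sym.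
- move=> le_ul; have := IHv; rewrite -(artin_size uv) => /(_ le_ul).
  have := IHu le_ul; have := artin_size uv.
  case: u v w le_ul {uv vw IHu IHv} => [|s u] [|c v] [|t w] //= le_ul [eq_uv].
  apply: resolves_trans; last by rewrite !artin_length_class.
  move=> s' t' X Y ltX; apply: IHl; apply: leq_trans ltX _.
  by rewrite artin_length_class -eq_uv.
move=> [|s u1] [|t v1] u2 v2 c1 IH1 c2 IH2 //=.
- by have := artin_size c1.
- by have := artin_size c1.
move=> le_l; rewrite !artin_class_cat.
have -> : art u2 = art v2 by apply/word_classP.
apply: resolvesM; apply: IH1; apply: leq_trans le_l.
by rewrite /= ltnS size_cat leq_addr.
Qed.

Theorem artin_cancel (a X Y : M) : a * X = a * Y -> X = Y.
Proof.
apply: (@lcm_below_cancel (len (a * X))) => // s t X' Y' _.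
exact: artin_resolves.
Qed.

End ArtinMonoid.

(** * Garside elements *)

Section Garside.
Variables (S : choiceType) (G : coxeter_graph S).
Local Notation M := (artin_monoid G).
Local Notation gen := (artin_gen G).
Local Notation art := (artin_class G).

Lemma artin_support u v : word_cong (artin_rel G) u v -> u =i v.
Proof.
elim=> {u v} // [u v [s t [|[|m]] st Gst] x|u v _ uv x|u v w _ uv _ vw x|].
- by [].
- by have := cox_mx_ge2 st Gst.
- have mem_alt (y z : S) : (x \in alternating y z m.+2) = (x \in [:: y; z]).
    apply/idP/idP => [|/=]; first exact/allP/mem_alternating.
    by rewrite !inE orbA => ->.
  by rewrite !mem_alt !inE orbC.
- by rewrite uv.
- by rewrite uv vw.
by move=> u1 v1 u2 v2 _ e1 _ e2 x; rewrite !mem_cat e1 e2.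
Qed.

Lemma artin_gen_inj : injective gen.
Proof.
move=> s t /word_classP/artin_support/(_ s).
by rewrite !inE eqxx => /esym/eqP.
Qed.

Lemma artin_conj (I : Type) (f g : I -> S) (X : M) :
    (forall i, gen (f i) * X = X * gen (g i)) ->
  forall w, art (map f w) * X = X * art (map g w).
Proof.
move=> fXg; elim=> [|i w IHw]; first by rewrite artin_class_nil mul1g mulg1.
by rewrite /= !artin_class_cons -mulgA IHw !mulgA fXg.
Qed.

(** If D = s E with E starting with s, the lcm property makes every other generator
divide E too, so the minimal common multiple D would divide the shorter E. *)
Lemma garside_square_free D phi s : spherical G -> is_garside D ->
    (forall t, gen t * D = D * gen (phi t)) ->
  ~ divides (gen s ^+ 2) D.
Proof.
move=> sphG [D_all D_min] conjD [A [B def_D]].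
(* A is moved to the right end of D = A s s B, where it becomes A'. *)
have [a def_A] := artin_classW A; pose A' := art (map phi a).
have AD : A * D = D * A'.
  by rewrite -(artin_conj conjD) map_id -def_A.
pose E := gen s * (B * A').
have def_DE : D = gen s * E.
  apply: (artin_cancel sphG (a := A)); rewrite AD {1}def_D expgS expg1.
  by rewrite /E !mulgA.
have [r] : ldivides D E.
  apply: D_min => t; have [eq_st|st] := pselect (s = t).
    by rewrite -eq_st; exists (B * A').
  have [Y def_Y] := D_all t.
  case: (artin_resolves sphG (etrans (esym def_DE) def_Y)) => [[]//|].
  case=> _ [[|m] [V [Gst -> _]]]; first by have := cox_mx_ge2 st Gst.
  by exists (art (alternating s t m) * V); rewrite mulgA -artin_class_cons.
move=> /(congr1 (@artin_length _ G)); rewrite def_DE !artin_lengthM artin_length_gen.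
by move=> /eqP; rewrite add1n addSn ltn_eqF // ltnS leq_addr.
Qed.

End Garside.

(** Braid relations preserve the set of letters of a word. *)
Lemma incl_ldivides_last n (G' : coxeter_graph 'I_n) (G : coxeter_graph 'I_n.+1) a :
  ~ ldivides (artin_gen G ord_max) (artin_incl (G' := G') G a).
Proof.
case=> r; have [u ->] := artin_classW r; rewrite -artin_class_cons.
move=> /word_classP/artin_support/(_ ord_max); rewrite mem_head.
by move=> /mapP[i _ /(congr1 val)/= /eqP]; rewrite gtn_eqF.
Qed.

Theorem proposition2 (n : nat) (hn : (2 <= n.+1)%N)
  (G' : coxeter_graph 'I_n) (G : coxeter_graph 'I_n.+1)
  (sphG' : spherical G') (sphG : spherical G) (sGG' : full_subgraph G' G)
  (D' : artin_monoid G') (gD' : is_garside D')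
  (D : artin_monoid G) (gD : is_garside D)
  (R : artin_monoid G) (defR : D = artin_incl G D' * R)
  (sigman : 'I_n.+1 -> 'I_n.+1) (sigman_bij : bijective sigman)
  (sigmanE : forall i, artin_gen G i * D = D * artin_gen G (sigman i))
  (m : 'I_n.+1) (defm : m = sigman ord_max)
  (sigma : 'I_n -> 'I_n.+1)
  (sigma_bij : set_bij [set: 'I_n]%classic [set~ m]%classic sigma)
  (sigmaE : forall i, artin_gen G (vertex_incl i) * R = R * artin_gen G (sigma i))
  (U : artin_monoid G)
  (Ua : ~ divides (artin_gen G m ^+ 2) U)
  (Ub : forall i, ldivides (artin_gen G i) U <-> i = ord_max)
  (k : 'I_n.+1) (tau : 'I_n -> 'I_n.+1)
  (tau_bij : set_bij [set: 'I_n]%classic [set~ k]%classic tau)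
  (Uc : forall i, artin_gen G (vertex_incl i) * U = U * artin_gen G (tau i)) :
  U = R /\ k = m /\ tau = sigma.
Proof.
have [sigma_ne_m _ sigma_onto] := sigma_bij.
pose V' (i : 'I_n) := vertex_incl i.
have D'_word i : exists w, artin_incl G D' = artin_class G (map V' (i :: w)).
  have [r ->] := gD'.1 i; have [w ->] := artin_classW r; exists w.
  by rewrite -artin_class_cons; exact: artin_incl_class.
have lift_or_last j : j = ord_max \/ exists i : 'I_n, j = V' i.
  have [lt_jn|le_nj] := ltnP j n; [right | left].
    by exists (Ordinal lt_jn); apply: val_inj.
  by apply: val_inj; apply/eqP; rewrite eqn_leq le_nj -ltnS ltn_ord.
(* Otherwise D = R1 x_j sigma(D'), where sigma(D') starts with x_j as well. *)
have R_ends j : j <> m -> forall R1, R <> R1 * artin_gen G j.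
  move=> /sigma_onto[i _ def_j] R1 def_R; have [w D'w] := D'_word i.
  apply: (garside_square_free sphG gD sigmanE (s := j)).
  exists R1, (artin_class G (map sigma w)).
  rewrite defR D'w (artin_conj sigmaE) /= artin_class_cons def_j {1}def_R.
  by rewrite expgS expg1 !mulgA.
have [R1 def_R] : exists R1, R = R1 * artin_gen G m.
  have [u def_u] := artin_classW R; case/lastP: u => [|u j] in def_u *.
    have [r] := gD.1 ord_max; rewrite {1}defR def_u artin_class_nil mulg1.
    by move=> incl_r; case: (@incl_ldivides_last n G' G D'); exists r.
  have [eq_jm|jm] := pselect (j = m).
    by exists (artin_class G u); rewrite def_u -cats1 artin_class_cat eq_jm.
  by case: (R_ends j jm (artin_class G u)); rewrite def_u -cats1 artin_class_cat.
(* As D' U = U tau(D') and U starts with the last generator, so does D' U. *)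
have [V def_DU] : ldivides D (artin_incl G D' * U).
  apply: gD.2 => j; have [->|[i ->]] := lift_or_last j.
    rewrite (artin_conj Uc (repr D')); apply: ldividesMr.
    exact/Ub.
  have [w ->] := D'_word i; rewrite /= artin_class_cons -mulgA.
  by exists (artin_class G (map V' w) * U).
have def_U : U = R * V.
  by apply: (artin_cancel sphG (a := artin_incl G D')); rewrite def_DU defR mulgA.
have V1 : V = 1.
  have [//|[j [V2 def_V]]] := artin_genW V.
  have [eq_jm|/sigma_onto[i _ def_j]] := pselect (j = m).
    case: Ua; exists R1, V2.
    by rewrite def_U def_V def_R eq_jm expgS expg1 !mulgA.
  have /Ub/(congr1 val)/= /eqP : ldivides (artin_gen G (V' i)) U.
    by exists (R * V2); rewrite def_U def_V -def_j !mulgA sigmaE.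
  by rewrite ltn_eqF.
have UR : U = R by rewrite def_U V1 mulg1.
have eq_ts : tau = sigma.
  apply/funext => i; apply: (@artin_gen_inj _ G).
  by apply: (artin_cancel sphG (a := R)); rewrite -sigmaE -{1}UR -Uc UR.
split=> //; split=> //; have [tau_ne_k _ _] := tau_bij.
have [//|/sigma_onto[i _ def_k]] := pselect (k = m).
by case: (tau_ne_k i I); rewrite eq_ts.
Qed.
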